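(* Let $X$ be an injective metric space and let $Y\subseteq X$ be a subset. Then $Y$ is Morse if and only if $Y$ is strongly contracting. Moreover, this is quantitative: for every Morse gauge $M$ there is a constant $D$, depending only on $M$, such that every $M$-Morse subset of any injective metric space is $D$-strongly contracting; and for every $D\ge 0$ there is a Morse gauge $M$, depending only on $D$, such that every $D$-strongly contracting subset of any injective metric space is $M$-Morse.
   Context: $B(x,r)$ denotes the closed ball of radius $r$ centred at $x$. A metric space $X$ is injective if for any families $\{x_i\}$ in $X$ and $\{r_i\}$ in $\mathbb{R}^+=[0,\infty)$ with $d(x_i,x_j)\le r_i+r_j$ for all $i\ne j$, one has $\bigcap_i B(x_i,r_i)\neq\emptyset$. For $\lambda\ge 1,\epsilon\ge 0$, a $(\lambda,\epsilon)$-quasi-geodesic in $X$ is a map $\beta:I\to X$ from an interval $I\subseteq\mathbb{R}$ with $\frac1\lambda|s-t|-\epsilon\le d(\beta(s),\beta(t))\le\lambda|s-t|+\epsilon$ for all $s,t\in I$. Given $M:\mathbb{R}^+\times\mathbb{R}^+\to\mathbb{R}^+$ (a Morse gauge), a subset $Y$ of a metric space is $M$-Morse if every $(\lambda,\epsilon)$-quasi-geodesic with endpoints on $Y$ is contained in the $M(\lambda,\epsilon)$-neighborhood of $Y$. $Y$ is Morse if it is $M$-Morse for some $M$. For $Y\subseteq X$ and $x\in X$, let $\pi_Y(x)=\{y\in Y: d(x,y)\le d(x,Y)+1\}$, and for $B\subseteq X$ let $\pi_Y(B)=\bigcup_{x\in B}\pi_Y(x)$. $Y$ is $D$-strongly contracting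 if $\mathrm{diam}(\pi_Y(B))\le D$ for every ball $B$ of $X$ disjoint from $Y$. $Y$ is strongly contracting if it is $D$-strongly contracting for some $D$. *)

(* Defs.v *)
From HB Require Import structures.
From mathcomp Require Import all_boot all_order all_algebra.
From mathcomp Require Import all_classical all_reals all_analysis.

Set Implicit Arguments.
Unset Strict Implicit.
Unset Printing Implicit Defensive.

Import Order.TTheory GRing.Theory Num.Theory.

Local Open Scope classical_set_scope.
Local Open Scope ring_scope.

(* The library's [closed_ball] is the closure of an open ball, which in a
   general metric space may be smaller than this set. *)
Definition cball (R : realType) (X : metricType R) (x : X) (r : R) : set X :=
  [set z | mdist x z <= r].

(* [\bigcap_i] over an empty family is [setT], so the empty family only forces
   [X] to be nonempty. *)
Definition injective_metric (R : realType) (X : metricType R) : Prop :=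
  forall (I : Type) (x : I -> X) (r : I -> R),
    (forall i, 0 <= r i) ->
    (forall i j, i <> j -> mdist (x i) (x j) <= r i + r j) ->
    \bigcap_i cball (x i) (r i) !=set0.

(* Extended-real valued: the distance to the empty set is [+oo]. *)
Definition dist_set (R : realType) (X : metricType R) (x : X) (Y : set X)
    : \bar R :=
  ereal_inf [set (mdist x y)%:E | y in Y].

Definition neighborhood (R : realType) (X : metricType R) (Y : set X) (r : R)
    : set X :=
  [set x | (dist_set x Y <= r%:E)%E].

(* Adding [0] gives the empty set diameter [0] instead of [-oo] and changes
   nothing for a nonempty set. *)
Definition diam (R : realType) (X : metricType R) (A : set X) : \bar R :=
  ereal_sup ([set 0%E] `|` [set (mdist p.1 p.2)%:E | p in A `*` A]).

(* Only the values of [b] on [I] matter. *)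
Definition quasi_geodesic (R : realType) (X : metricType R) (l e : R)
    (I : set R) (b : R -> X) : Prop :=
  [/\ 1 <= l, 0 <= e, is_interval I &
      forall s t, I s -> I t ->
        l^-1 * `|s - t| - e <= mdist (b s) (b t) <= l * `|s - t| + e].

(* A map from R^+ x R^+ to R^+, as a function on R whose values at negative
   arguments are irrelevant. *)
Definition morse_gauge (R : realType) (M : R -> R -> R) : Prop :=
  forall l e, 0 <= l -> 0 <= e -> 0 <= M l e.

(* A quasi-geodesic has endpoints when its domain is a compact interval. *)
Definition morse_with (R : realType) (X : metricType R) (M : R -> R -> R)
    (Y : set X) : Prop :=
  forall (l e s t : R) (b : R -> X),
    s <= t -> quasi_geodesic l e `[s, t] b -> Y (b s) -> Y (b t) ->
    b @` `[s, t] `<=` neighborhood Y (M l e).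

Definition morse (R : realType) (X : metricType R) (Y : set X) : Prop :=
  exists2 M : R -> R -> R, morse_gauge M & morse_with M Y.

Definition coarse_proj (R : realType) (X : metricType R) (Y : set X) (x : X)
    : set X :=
  [set y | Y y /\ ((mdist x y)%:E <= dist_set x Y + 1)%E].

Definition coarse_proj_set (R : realType) (X : metricType R) (Y B : set X)
    : set X :=
  \bigcup_(x in B) coarse_proj Y x.

Definition strongly_contracting_with (R : realType) (X : metricType R) (D : R)
    (Y : set X) : Prop :=
  forall (x : X) (r : R), 0 <= r -> cball x r `&` Y = set0 ->
    (diam (coarse_proj_set Y (cball x r)) <= D%:E)%E.

Definition strongly_contracting (R : realType) (X : metricType R) (Y : set X)
    : Prop :=
  exists2 D : R, 0 <= D & strongly_contracting_with D Y.

(* Main.v *)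
Require Import Defs.
From HB Require Import structures.
From mathcomp Require Import all_boot all_order all_algebra.
From mathcomp Require Import all_classical all_reals all_analysis.
From mathcomp Require Import ring lra.

Set Implicit Arguments.
Unset Strict Implicit.
Unset Printing Implicit Defensive.

Import Order.TTheory GRing.Theory Num.Theory.

Local Open Scope classical_set_scope.
Local Open Scope ring_scope.

(** Strong contraction implies Morse, in every metric space.  Let [b] be an
    [(l, e)]-quasi-geodesic with endpoints on [Y].  From a time [u], walk along
    [b] in both directions with a fixed step [tau] until coming within a
    distance [J] of [Y], where [J] bounds how far [b] moves in one step.  Before
    that, each step stays in a ball disjoint from [Y], so the coarse projection
    to [Y] moves by at most [D] ([contracting_step], [contracting_walk]).  After
    [k] steps in all, the two stopping points are thus at most [2 (J + 1) + k D]
    apart, while the quasi-geodesic inequality keeps them about [k tau / l]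
    apart.  With [tau = l (D + 1)] this bounds [k], hence the time needed to
    come back near [Y], hence the distance from [b u] to [Y]
    ([contracting_morse]).

    Morse implies strong contraction, in an injective space.  Injectivity is
    used in two ways: it gives points at prescribed distances from finitely many
    given ones ([injective_balls]), and it extends 1-Lipschitz maps from finite
    subsets of the line to the whole line ([lipschitz_extension]), so that paths
    can be drawn through such points.

    Let [y] be a coarse projection of [x] and [y'] a point of [Y].  The triangle
    [x, y, y'] has a centre [c] lying on a geodesic for each pair.  Being on a
    geodesic between points of [Y], [c] is close to [Y]; being on a geodesic
    from [x] to its projection [y], it has no point of [Y] nearer than [y] by
    more than [1].  So [c] is close to [y], that is, [d(x, y')] is
    [d(x, y) + d(y, y')] up to a constant [C] ([morse_proj_tripod]).

    Let moreover [y'] be a coarse projection of a point [z] with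
    [d(x, z) <= d(x, y)], as happens for [z] in a ball about [x] disjoint from
    [Y].  Put [L = d(y, y')] and [h = L - C].  The four points [x, z, y, y']
    then span an almost [l^1] rectangle with base [y, y'] and height at least
    [h]: by injectivity there are [x'] at height [h] above [y] towards [x] and
    [z'] at height [h] above [y'] towards [z] with [d(x', z') <= L].  Going up
    from [y] to [x'], across to [z'] and down to [y'] is a
    [(3, C)]-quasi-geodesic with endpoints on [Y] whose corner [x'] is at
    distance at least [h - 1] from [Y].  The Morse property bounds [h], hence
    [L] ([morse_proj_ball]). *)

(** * Real-valued forms of the coarse notions *)

Section Metric.
Context {R : realType} {X : metricType R}.
Implicit Types (x y z : X) (Y A : set X).

Lemma coarse_projP Y x y :
  coarse_proj Y x y <->
  Y y /\ forall y', Y y' -> mdist x y <= mdist x y' + 1.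
Proof.
rewrite /coarse_proj /dist_set /= -leeBlDr//.
split=> -[Yy xy]; split=> //.
  move=> y' Yy'; move/ereal_infP: xy => /(_ (mdist x y')%:E) xy.
  by rewrite -lerBlDr -lee_fin EFinB; apply: xy; exists y'.
apply/ereal_infP => _ [y' Yy' <-].
by rewrite -EFinB lee_fin lerBlDr; exact: xy.
Qed.

Lemma coarse_proj_id Y x : Y x -> coarse_proj Y x x.
Proof.
move=> Yx; apply/coarse_projP; split=> // y _.
by rewrite mdistxx addr_ge0// mdist_ge0.
Qed.

(** The slack [1] in the definition makes up for an infimum that is not
    attained. *)
Lemma coarse_proj_nonempty Y x : Y !=set0 -> coarse_proj Y x !=set0.
Proof.
move=> [y0 Yy0]; pose E := [set mdist x y | y in Y].
have Elb : has_lbound E by exists 0 => _ [y _ <-]; exact: mdist_ge0.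
have Einf : has_inf E by split=> //; exists (mdist x y0), y0.
have [_ [y Yy <-] xy] := inf_adherent ltr01 Einf.
exists y; apply/coarse_projP; split=> // y' Yy'.
apply: (le_trans (ltW xy)); rewrite lerD2r.
by apply: ge_inf => //; exists y'.
Qed.

Lemma neighborhood_ge Y (r a : R) x :
  neighborhood Y r x -> (forall y, Y y -> a <= mdist x y) -> a <= r.
Proof.
move=> xr ax; rewrite -lee_fin; apply: le_trans xr.
by apply/ereal_infP => _ [y Yy <-]; rewrite lee_fin; exact: ax.
Qed.

Lemma mem_neighborhood Y (r : R) x y :
  Y y -> mdist x y <= r -> neighborhood Y r x.
Proof.
by move=> Yy xy; apply: ge_ereal_inf; exists (mdist x y)%:E => //; exists y.
Qed.

Lemma diam_leP A (D : R) : 0 <= D ->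
  (diam A <= D%:E)%E <-> {in A &, forall x y, mdist x y <= D}.
Proof.
move=> D0; split=> [/ereal_supP AD x y /set_mem Ax /set_mem Ay|AD].
  by rewrite -lee_fin; apply: AD; right; exists (x, y).
apply/ereal_supP => _ [->|[[x y] /= [Ax Ay] <-]]; rewrite lee_fin//.
by apply: AD; exact/mem_set.
Qed.

(** * Strong contraction implies Morse *)

(** The ball about [x] of radius [J] contains [x'] and misses [Y]. *)
Lemma contracting_step D Y (J : R) x x' y y' : 0 <= D ->
  strongly_contracting_with D Y ->
  mdist x x' <= J -> (forall w, Y w -> J < mdist x w) ->
  coarse_proj Y x y -> coarse_proj Y x' y' -> mdist y y' <= D.
Proof.
move=> D0 SC xx' far xy xy'.
have J0 : 0 <= J by apply: le_trans xx'; exact: mdist_ge0.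
have disj : cball x J `&` Y = set0.
  rewrite -subset0 => w [xw Yw]; move: (far _ Yw).
  by rewrite ltNge; move: xw; rewrite /cball/= => ->.
have /(diam_leP _ D0) := SC x J J0 disj.
apply; apply/mem_set; first by exists x => //; rewrite /cball/= mdistxx.
by exists x'.
Qed.

(** One half of the walk along a quasi-geodesic: [m] steps lead from [a] to a
    time [v] at which [f] is back near [Y], the walk stopping at [l] at the
    latest, by a step that may be shortened.  The number [n] bounds the length
    of the walk, for the induction. *)
Lemma contracting_walk D Y (J tau l : R) (f : R -> X) : 0 <= D ->
  strongly_contracting_with D Y -> 0 < tau -> Y (f l) ->
  (forall a b, 0 <= a -> a <= b -> b <= l -> b - a <= tau ->
     mdist (f a) (f b) <= J) ->
  forall (n : nat) (a : R) (p : X), 0 <= a -> a <= l -> l - a <= n%:R * tau ->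
    coarse_proj Y (f a) p ->
    exists (m : nat) (v : R) (q : X),
      [/\ a <= v <= l, a + m%:R * tau - tau <= v <= a + m%:R * tau,
          coarse_proj Y (f v) q, mdist p q <= m%:R * D
        & mdist (f v) q <= J + 1].
Proof.
move=> D0 SC tau0 Yl fJ; elim=> [|n IH] a p a0 al lan ap;
  have [[y [Yy ay]]|nofar] := pselect (exists y, Y y /\ mdist (f a) y <= J).
- exists 0%N, a, p; rewrite !mul0r mdistxx lexx al; split=> //.
    by apply/andP; split; lra.
  by have /coarse_projP[_ /(_ _ Yy)] := ap; lra.
- have al' : a = l by lra.
  exfalso; apply: nofar; exists (f l); split=> //.
  by rewrite al'; apply: fJ; lra.
- exists 0%N, a, p; rewrite !mul0r mdistxx lexx al; split=> //.
    by apply/andP; split; lra.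
  by have /coarse_projP[_ /(_ _ Yy)] := ap; lra.
- have far w : Y w -> J < mdist (f a) w.
    by move=> Yw; rewrite ltNge; apply/negP => aw; apply: nofar; exists w.
  have [lt|gt] := leP l (a + tau).
    exists 1%N, l, (f l); rewrite !mul1r; split.
    + by rewrite al lexx.
    + by apply/andP; split; lra.
    + exact: coarse_proj_id.
    + apply: (contracting_step D0 SC _ far ap (coarse_proj_id Yl)).
      by apply: fJ; lra.
    + have := fJ l l; rewrite !mdistxx => fl.
      have : 0 <= J by apply: fl; lra.
      by lra.
  have Y0 : Y !=set0 by exists (f l).
  have [p' ap'] := coarse_proj_nonempty (f (a + tau)) Y0.
  have pp' : mdist p p' <= D.
    by apply: (contracting_step D0 SC _ far ap ap'); apply: fJ; lra.
  move: lan; rewrite -natr1 mulrDl mul1r => lan.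
  have [| | |m [v [q [/andP[av vl] /andP[mv vm] vq p'q vJ]]]] :=
    IH (a + tau) p' _ _ _ ap'; try lra.
  exists m.+1, v, q; rewrite -natr1 !mulrDl !mul1r; split=> //.
  + by apply/andP; split; lra.
  + by apply/andP; split; lra.
  + by have := metric_triangle p p' q; lra.
Qed.

End Metric.

(** Here [tau] is the step of the walk, and [J] bounds the displacement of an
    [(l, e)]-quasi-geodesic in time [tau].  The factor
    [e + 2 (J + 1) + 2 (D + 1)] bounds the total number of steps [k], since
    [(k - 2) (D + 1) - e <= 2 (J + 1) + k D]; the [- 2] accounts for the
    shortened last step in each direction. *)
Definition contracting_gauge {R : realType} (D l e : R) : R :=
  let tau := l * (D + 1) in
  let J := l * tau + e in
  l * (tau * (e + 2 * (J + 1) + 2 * (D + 1))) + e + J + 1.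

Lemma contracting_gauge_ge0 (R : realType) (D : R) :
  0 <= D -> morse_gauge (contracting_gauge D).
Proof.
move=> D0 l e l0 e0; rewrite /contracting_gauge.
by do ![apply: addr_ge0 | apply: mulr_ge0 | done].
Qed.

Lemma contracting_morse (R : realType) (X : metricType R) (D : R) (Y : set X) :
  0 <= D -> strongly_contracting_with D Y ->
  morse_with (contracting_gauge D) Y.
Proof.
move=> D0 SC l e s t b st [l1 e0 _ qg] Ys Yt _ [u + <-].
rewrite /= in_itv/= => /andP[su ut].
rewrite /contracting_gauge.
set tau := l * (D + 1); set J := l * tau + e; set N := e + 2 * (J + 1) + _.
have l0 : 0 < l by lra.
have tau0 : 0 < tau by rewrite /tau mulr_gt0//; lra.
have upper a c : s <= a -> a <= c -> c <= t ->
    mdist (b a) (b c) <= l * (c - a) + e.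
  move=> sa ac ct; have /andP[_] := qg a c ltac:(rewrite /= in_itv/=; lra)
    ltac:(rewrite /= in_itv/=; lra).
  by rewrite distrC ger0_norm//; lra.
have upperJ a c : s <= a -> a <= c -> c <= t -> c - a <= tau ->
    mdist (b a) (b c) <= J.
  move=> sa ac ct ca; apply: (le_trans (upper _ _ sa ac ct)).
  by rewrite /J lerD2r ler_pM2l.
have Y0 : Y !=set0 by exists (b s).
have [p up] := coarse_proj_nonempty (b u) Y0.
have nat_ub (d : R) : 0 <= d -> exists n : nat, d <= n%:R * tau.
  move=> d0; exists (Num.truncn (d / tau)).+1.
  by rewrite -ler_pdivrMr//; apply/ltW/truncnS_gt.
have [n1 hn1] := nat_ub (t - u) ltac:(lra).
have [n2 hn2] := nat_ub (u - s) ltac:(lra).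
have [| | | | | |m [v [q [/andP[v0 vl] /andP[mv vm] vq pq vJ]]]] :=
  @contracting_walk R X D Y J tau (t - u) (fun a => b (u + a))
    D0 SC tau0 _ _ n1 0 p.
- by rewrite addrC subrK.
- by move=> a c a0 ac cl ca; apply: upperJ; lra.
- by [].
- by lra.
- by rewrite subr0.
- by rewrite addr0.
have [| | | | | |n [w [p2 [/andP[w0 wl] /andP[nw wn] wo po wJ]]]] :=
  @contracting_walk R X D Y J tau (u - s) (fun a => b (u - a))
    D0 SC tau0 _ _ n2 0 p.
- by rewrite opprB addrC subrK.
- by move=> a c a0 ac cl ca; rewrite metric_sym; apply: upperJ; lra.
- by [].
- by lra.
- by rewrite subr0.
- by rewrite subr0.
have /andP[lower _] := qg (u - w) (u + v) ltac:(rewrite /= in_itv/=; lra)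
    ltac:(rewrite /= in_itv/=; lra).
have n0 : 0 <= n%:R :> R := ler0n _ _.
have m0 : 0 <= m%:R :> R := ler0n _ _.
have short : mdist (b (u - w)) (b (u + v)) <= 2 * (J + 1) + (m%:R + n%:R) * D.
  have := metric_triangle (b (u - w)) p2 (b (u + v)).
  have := metric_triangle p2 p (b (u + v)).
  have := metric_triangle p q (b (u + v)).
  by rewrite (metric_sym p2 p) (metric_sym q (b _)); lra.
have long : (m%:R + n%:R - 2) * (D + 1) <= l^-1 * `|u - w - (u + v)|.
  rewrite ler_pdivlMl// mulrCA -/tau.
  have -> : u - w - (u + v) = - (w + v) by ring.
  by rewrite normrN ger0_norm; lra.
have mN : m%:R <= N by rewrite /N; lra.
have [Yq _] := (coarse_projP _ _ _).1 vq.
apply: (mem_neighborhood Yq).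
have uv := upper u (u + v) ltac:(lra) ltac:(lra) ltac:(lra).
have lv : l * (u + v - u) <= l * (tau * N).
  rewrite ler_pM2l//.
  have : m%:R * tau <= N * tau by rewrite ler_pM2r.
  by lra.
by have := metric_triangle (b u) (b (u + v)) q; lra.
Qed.

(** * Lipschitz paths *)

Section LipschitzPaths.
Context {R : realType} {X : metricType R}.

Lemma ler_dist_sub (r a b : R) : a + r <= b -> r <= `|a - b|.
Proof. by move=> arb; rewrite distrC ler_normr lerBrDl arb. Qed.

Lemma lipschitz_quasi_geodesic (l e a b : R) (g : R -> X) : 1 <= l -> 0 <= e ->
  (forall s t, mdist (g s) (g t) <= `|s - t|) ->
  (forall s t, a <= s -> s <= t -> t <= b ->
     t - s <= l * (mdist (g s) (g t) + e)) ->
  quasi_geodesic l e `[a, b] g.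
Proof.
move=> l1 e0 g_lip lower; split=> //; first exact: interval_is_interval.
have l0 : 0 < l by lra.
move=> s t; wlog st : s t / s <= t.
  move=> th; have [|/ltW] := leP s t; first exact: th.
  by move=> ts sI tI; rewrite distrC metric_sym; exact: th.
rewrite /= !in_itv/= => /andP[sa sb] /andP[ta tb]; apply/andP; split.
  by rewrite lerBlDr ler_pdivrMl// distrC ger0_norm ?subr_ge0//; exact: lower.
apply: (le_trans (g_lip s t)).
have : `|s - t| <= l * `|s - t| by rewrite ler_peMl.
by lra.
Qed.

(** If the ends of a 1-Lipschitz path are as far apart as possible up to [C], so
    are any two of its points: a shortcut in between would bring the ends closer
    together. *)
Lemma lipschitz_almost_geodesic (a b C : R) (g : R -> X) :
  (forall s t, mdist (g s) (g t) <= `|s - t|) ->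
  b - a <= mdist (g a) (g b) + C ->
  forall s t, a <= s -> s <= t -> t <= b -> t - s <= mdist (g s) (g t) + C.
Proof.
move=> g_lip gab s t sa st tb.
have := g_lip a s; have := g_lip t b.
rewrite !(distrC _ s) !(distrC _ b) !ger0_norm ?subr_ge0//.
have := metric_triangle (g a) (g s) (g b).
by have := metric_triangle (g s) (g t) (g b); lra.
Qed.

End LipschitzPaths.

(** * Points and paths in injective spaces *)

Section Injective.
Context {R : realType} {X : metricType R} (injX : injective_metric X).
Implicit Types (x y z : X) (Y : set X).

Lemma injective_balls (s : seq (X * R)) :
  all (fun p => 0 <= p.2) s ->
  pairwise (fun p q => mdist p.1 q.1 <= p.2 + q.2) s ->
  exists c, all (fun p => mdist p.1 c <= p.2) s.
Proof.
(* Even the empty family of balls has a common point, as [X] is nonempty. *)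
case: s => [_ _|p0 s0].
  have no_pt (i : False) := match i return X with end.
  by have [i|i j|c _] := @injX False no_pt (fun=> 0);
    [case: i|case: i|exists c].
set s := p0 :: s0 => s_ge0 /(pairwiseP p0) sP.
have [||c cP] := @injX 'I_(size s) (fun i => (nth p0 s i).1)
  (fun i => (nth p0 s i).2).
- by move=> i; apply: (allP s_ge0); rewrite mem_nth.
- move=> i j /eqP; rewrite -val_eqE neq_ltn => /orP[] ij.
    exact: sP (ltn_ord i) (ltn_ord j) ij.
  by rewrite metric_sym addrC; exact: sP (ltn_ord j) (ltn_ord i) ij.
exists c; apply/(all_nthP p0) => i si.
exact: cP (Ordinal si) I.
Qed.

(** A partial 1-Lipschitz map is handled through its graph [G]: the Lipschitz
    inequality between any two points of [G] already makes [G] functional.  A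
    maximal such graph containing [s] is defined at every [a], since the balls
    about its values [x] at [t] with radius [`|t - a|] meet pairwise, hence have
    a common point, which is an admissible value at [a]. *)
Lemma lipschitz_extension (s : seq (R * X)) :
  pairwise (fun p q => mdist p.2 q.2 <= `|p.1 - q.1|) s ->
  exists2 g : R -> X, forall a b, mdist (g a) (g b) <= `|a - b| &
    all (fun p => g p.1 == p.2) s.
Proof.
rewrite pairwise_all2rel; last 2 first.
- by move=> p; rewrite mdistxx.
- by move=> p q; rewrite metric_sym distrC.
move=> /allrelP s_lip.
pose lip (G : set (R * X)) :=
  forall p q, G p -> G q -> mdist p.2 q.2 <= `|p.1 - q.1|.
have lip_val G a x y : lip G -> G (a, x) -> G (a, y) -> x = y.
  move=> lipG Gx Gy; apply: mdist_positivity.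
  apply/eqP; rewrite eq_le mdist_ge0 andbT.
  by have := lipG _ _ Gx Gy; rewrite subrr normr0.
(* Adjoining [s] in the predicate makes it hold for the union of the empty
   chain. *)
have [F FP Ftot|G [lipG Gmax]] :=
  @Zorn_bigcup _ [set G | lip (G `|` [set` s])].
- move=> p q [[G1 F1 G1p]|sp] [[G2 F2 G2q]|sq].
  + have [G12|G21] := Ftot _ _ F1 F2.
    * by apply: (FP _ F2); left; [exact: G12|].
    * by apply: (FP _ F1); left; [|exact: G21].
  + by apply: (FP _ F1); [left|right].
  + by apply: (FP _ F2); [right|left].
  + exact: s_lip.
pose H : set (R * X) := G `|` [set` s].
have total a : exists x, H (a, x).
  have [|k l|x xP] := @injX {p | H p} (fun k => (sval k).2)
    (fun k => `|(sval k).1 - a|); first by move=> k; exact: normr_ge0.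
    move=> _; apply: le_trans (lipG _ _ (svalP k) (svalP l)) _.
    by rewrite (distrC (sval l).1 a); exact: ler_distD.
  have near_x p : H p -> mdist p.2 x <= `|p.1 - a|.
    by move=> Hp; exact: (xP (exist _ p Hp)).
  have [Ga|nGa] := pselect (G (a, x)); first by exists x; left.
  exfalso; apply: (Gmax ((a, x) |` G)).
    by split=> [p Gp|sub]; [right|apply: nGa; apply: sub; left].
  move=> p q; rewrite -setUA => -[->|Hp] [->|Hq] /=.
  + by rewrite mdistxx normr_ge0.
  + by rewrite metric_sym distrC; exact: near_x.
  + exact: near_x.
  + exact: lipG.
have [g gH] := choice total.
exists g => [a b|]; first exact: lipG (gH a) (gH b).
by apply/allP => -[a x] sx /=; apply/eqP; apply: (lip_val H a) => //; right.
Qed.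

(** * Morse implies strong contraction *)

(** The point [c] of the proof is the centre of the triangle [x, y, y'], and [a]
    is the Gromov product of [x] and [y'] at [y]; the claim is that [a] is at
    most [M 1 0 + 1]. *)
Lemma morse_proj_tripod (M : R -> R -> R) Y x y y' :
  morse_with M Y -> coarse_proj Y x y -> Y y' ->
  mdist x y + mdist y y' <= mdist x y' + 2 * (M 1 0 + 1).
Proof.
move=> MY /coarse_projP[Yy xy] Yy'.
set P := mdist x y; set Q := mdist y y'; set S := mdist x y'.
have tP : P <= S + Q.
  by have := metric_triangle x y' y; rewrite (metric_sym y' y).
have tQ : Q <= P + S.
  by have := metric_triangle y x y'; rewrite (metric_sym y x).
have tS : S <= P + Q := metric_triangle x y y'.
pose a := (P + Q - S) / 2.
have [||c] := injective_balls (s := [:: (y, a); (x, P - a); (y', Q - a)]).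
- by rewrite /= /a !andbT; apply/and3P; split; lra.
- rewrite /= !andbT (metric_sym y x) -/P -/Q -/S.
  by apply/andP; split; [apply/andP; split|]; rewrite /a; lra.
rewrite /= andbT => /and3P[yc xc y'c].
have yc_ge : a <= mdist y c.
  by have := metric_triangle y c y'; rewrite (metric_sym c y') -/Q; lra.
have [|g g_lip] := lipschitz_extension (s := [:: (0, y); (a, c); (Q, y')]).
  rewrite /= !andbT -/Q (metric_sym c y').
  by do ![apply/andP; split]; apply: ler_dist_sub;
    rewrite /a in yc xc y'c *; lra.
rewrite /= andbT => /and3P[/eqP g0 /eqP ga /eqP gQ].
have a0 : 0 <= a by rewrite /a; lra.
have aQ : a <= Q by rewrite /a; lra.
have qg : quasi_geodesic 1 0 `[0, Q] g.
  apply: lipschitz_quasi_geodesic => // s t s0 st tQ'; rewrite mul1r.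
  by apply: (lipschitz_almost_geodesic g_lip) s0 st tQ'; rewrite g0 gQ -/Q; lra.
have cM : neighborhood Y (M 1 0) c.
  rewrite -ga; apply: (MY _ _ _ _ _ _ qg); rewrite ?g0 ?gQ//; first by lra.
  by exists a => //; rewrite /= in_itv/= a0 aQ.
have := neighborhood_ge (a := a - 1) cM.
have far w : Y w -> a - 1 <= mdist c w.
  move=> Yw; have := xy w Yw; have := metric_triangle x c w.
  by rewrite -/P; lra.
by move=> /(_ far); rewrite /a; lra.
Qed.

(** The rectangle argument.  The hypothesis on [d(x, z)] is what allows the two
    sides of length [h] to stay at distance [L]: in a tree, with [x] and [z] far
    out on different branches, no such [x'] and [z'] exist. *)
Lemma morse_proj_ball (M : R -> R -> R) Y x z y y' :
  morse_gauge M -> morse_with M Y ->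
  coarse_proj Y x y -> coarse_proj Y z y' -> mdist x z <= mdist x y ->
  mdist y y' <= 2 * (M 1 0 + 1) + 1 + M 3 (2 * (M 1 0 + 1)).
Proof.
move=> Mge0 MY xy zy' xz.
have [Yy xyle] := (coarse_projP _ _ _).1 xy.
have [Yy' _] := (coarse_projP _ _ _).1 zy'.
have tx := morse_proj_tripod MY xy Yy'.
have tz := morse_proj_tripod MY zy' Yy.
have M10 : 0 <= M 1 0 by apply: Mge0.
move: tx tz; set C := 2 * (M 1 0 + 1); set L := mdist y y'.
rewrite (metric_sym y' y) -/L => tx tz.
have C0 : 0 <= C by rewrite /C; lra.
have M3 : 0 <= M 3 C by apply: Mge0.
have [LC|CL] := leP L C; first by lra.
have [h hE] : exists h, h = L - C by exists (L - C).
have h0 : 0 <= h by lra.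
have xy'le := metric_triangle x z y'.
have zyle := metric_triangle z x y; rewrite (metric_sym z x) in zyle.
have xy'le2 : mdist x y' <= mdist x y + L := metric_triangle x y y'.
have yzle : mdist y z <= L + mdist z y'.
  by rewrite (metric_sym z y'); exact: metric_triangle.
have zy'ge := mdist_ge0 z y'.
(* The bounds on the distances from [x'] to [z] and to [y'] are those needed for
   [z'] to exist afterwards. *)
have [||x'] := injective_balls (s := [:: (y, h); (x, mdist x y - h);
    (z, mdist z y' - h + L); (y', h + L)]).
- by rewrite /= !andbT; apply/and4P; split; lra.
- rewrite /= !andbT (metric_sym y x) -/L.
  by apply/and3P; split; [apply/and3P; split|apply/andP; split|]; lra.
rewrite /= andbT => /and4P[yx' xx' zx' y'x'].
have [||z'] :=
  injective_balls (s := [:: (y', h); (z, mdist z y' - h); (x', L)]).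
- by rewrite /= !andbT; apply/and3P; split; lra.
- rewrite /= !andbT (metric_sym y' z).
  by apply/andP; split; [apply/andP; split|]; lra.
rewrite /= andbT => /and3P[y'z' zz' x'z'].
have yx'ge : h <= mdist y x'.
  by have := metric_triangle x x' y; rewrite (metric_sym x' y); lra.
have y'z'ge : h <= mdist y' z'.
  by have := metric_triangle z z' y'; rewrite (metric_sym z' y'); lra.
(* Both halves [y, x', z'] and [x', z', y'] are almost geodesic, as their ends
   are [2 h = h + L - C] apart. *)
have x'y'ge : 2 * h <= mdist x' y'.
  by have := metric_triangle x x' y'; lra.
have yz'ge : 2 * h <= mdist y z'.
  by have := metric_triangle z z' y; rewrite (metric_sym z' y); lra.
have yz'le := metric_triangle y x' z'.
have [|g g_lip] := lipschitz_extension
    (s := [:: (0, y); (h, x'); (h + L, z'); (h + L + h, y')]).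
  have L0 : 0 <= L := mdist_ge0 y y'.
  rewrite /= !andbT -/L (metric_sym x' y') (metric_sym z' y').
  by do ![apply/andP; split]; apply: ler_dist_sub; lra.
rewrite /= andbT => /and4P[/eqP g0 /eqP gh /eqP ghL /eqP ghLh].
have L0 : 0 <= L := mdist_ge0 y y'.
have left_half : forall s t, 0 <= s -> s <= t -> t <= h + L ->
    t - s <= mdist (g s) (g t) + C.
  by apply: lipschitz_almost_geodesic => //; rewrite g0 ghL; lra.
have right_half : forall s t, h <= s -> s <= t -> t <= h + L + h ->
    t - s <= mdist (g s) (g t) + C.
  by apply: lipschitz_almost_geodesic => //; rewrite gh ghLh; lra.
have qg : quasi_geodesic 3 C `[0, h + L + h] g.
  apply: lipschitz_quasi_geodesic => // [|s t s0 st tb]; first by lra.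
  have d0 := mdist_ge0 (g s) (g t).
  have [thL|hLt] := leP t (h + L).
    by have := left_half s t s0 st thL; lra.
  have [hs|sh] := leP h s; first by have := right_half s t hs st tb; lra.
  (* Now [g s] and [g t] lie on the two vertical sides, at heights [s] and
     [h + L + h - t].  The distance from [g s] to [y'] is at least its height
     plus [h], so [g s] is at least [h] plus the difference of heights away from
     [g t], and symmetrically.  Thus they are at least [h] apart, while
     [t - s <= 2 h + L = 3 h + C]. *)
  have sx' := g_lip s h; rewrite gh distrC ger0_norm in sx'; last by lra.
  have sy := g_lip 0 s; rewrite g0 distrC ger0_norm in sy; last by lra.
  have tz' := g_lip (h + L) t; rewrite ghL distrC ger0_norm in tz'; last by lra.
  have ty' := g_lip t (h + L + h).
  rewrite ghLh distrC ger0_norm in ty'; last by lra.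
  have up_s : s + h <= mdist (g s) y'.
    by have := metric_triangle x' (g s) y'; rewrite (metric_sym x' (g s)); lra.
  have up_t : h + L + h - t + h <= mdist y (g t).
    by have := metric_triangle y (g t) z'; rewrite (metric_sym (g t) z'); lra.
  have d_s := metric_triangle (g s) (g t) y'.
  have d_t := metric_triangle y (g s) (g t).
  by lra.
have x'M : neighborhood Y (M 3 C) x'.
  rewrite -gh; apply: (MY _ _ _ _ _ _ qg); rewrite ?g0 ?ghLh//; first by lra.
  by exists h => //; rewrite /= in_itv/=; lra.
have far w : Y w -> h - 1 <= mdist x' w.
  by move=> Yw; have := xyle w Yw; have := metric_triangle x x' w; lra.
by have := neighborhood_ge x'M far; lra.
Qed.

(** Two projections of points of a ball are compared through a projection of its
    centre, whence the factor [2]. *)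
Lemma morse_contracting (M : R -> R -> R) Y :
  morse_gauge M -> morse_with M Y ->
  strongly_contracting_with
    (2 * (2 * (M 1 0 + 1) + 1 + M 3 (2 * (M 1 0 + 1)))) Y.
Proof.
move=> Mge0 MY x r r0 disj.
have M10 : 0 <= M 1 0 by apply: Mge0.
have M3 : 0 <= M 3 (2 * (M 1 0 + 1)) by apply: Mge0; lra.
apply/diam_leP; first by lra.
move=> y1 y2 /set_mem[z1 xz1 zy1] /set_mem[z2 xz2 zy2].
have [Yy1 _] := (coarse_projP _ _ _).1 zy1.
have [y xy] : coarse_proj Y x !=set0 by apply: coarse_proj_nonempty; exists y1.
have [Yy _] := (coarse_projP _ _ _).1 xy.
have rxy : r <= mdist x y.
  rewrite leNgt; apply/negP => /ltW yr.
  by have : (cball x r `&` Y) y by []; rewrite disj.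
have yy1 := morse_proj_ball Mge0 MY xy zy1 (le_trans xz1 rxy).
have yy2 := morse_proj_ball Mge0 MY xy zy2 (le_trans xz2 rxy).
by have := metric_triangle y1 y y2; rewrite (metric_sym y1 y); lra.
Qed.

End Injective.

Theorem theorem1 (R : realType) :
  [/\ forall (X : metricType R) (Y : set X), injective_metric X ->
        (morse Y <-> strongly_contracting Y),
      forall M : R -> R -> R, morse_gauge M ->
        exists2 D : R, 0 <= D &
          forall (X : metricType R) (Y : set X), injective_metric X ->
            morse_with M Y -> strongly_contracting_with D Y &
      forall D : R, 0 <= D ->
        exists2 M : R -> R -> R, morse_gauge M &
          forall (X : metricType R) (Y : set X), injective_metric X ->
            strongly_contracting_with D Y -> morse_with M Y].
Proof.
have to_contr (M : R -> R -> R) : morse_gauge M -> exists2 D : R, 0 <= D &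
    forall (X : metricType R) (Y : set X), injective_metric X ->
      morse_with M Y -> strongly_contracting_with D Y.
  move=> Mge0; exists (2 * (2 * (M 1 0 + 1) + 1 + M 3 (2 * (M 1 0 + 1)))).
    have M10 : 0 <= M 1 0 by apply: Mge0.
    have : 0 <= M 3 (2 * (M 1 0 + 1)) by apply: Mge0; lra.
    by lra.
  by move=> X Y injX; exact: morse_contracting.
have to_morse (D : R) : 0 <= D -> exists2 M : R -> R -> R, morse_gauge M &
    forall (X : metricType R) (Y : set X), injective_metric X ->
      strongly_contracting_with D Y -> morse_with M Y.
  move=> D0; exists (contracting_gauge D); first exact: contracting_gauge_ge0.
  by move=> X Y _; exact: contracting_morse.
split=> // X Y injX; split=> [[M Mge0 MY]|[D D0 DY]].
  by have [D D0 /(_ _ _ injX MY)] := to_contr M Mge0; exists D.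
by have [M Mge0 /(_ _ _ injX DY)] := to_morse D D0; exists M.
Qed.
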